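(* Let $m$ be a positive integer. Every strongly connected digraph $D$ with $\delta^0(D)\ge m+1$ contains a dipath $P$ of order $m$ such that $D-V(P)$ is strongly connected.
   Context: All digraphs are finite (with nonempty vertex set), loopless, and have no parallel arcs; oppositely directed arcs $(u,v)$ and $(v,u)$ are allowed. For a vertex $v$ of a digraph $D$, $d_D^+(v)$ and $d_D^-(v)$ denote its outdegree and indegree. The minimum semidegree is $\delta^0(D)=\min\{\delta^+(D),\delta^-(D)\}$, where $\delta^+(D)=\min_{v\in V(D)} d_D^+(v)$ and $\delta^-(D)=\min_{v\in V(D)} d_D^-(v)$. A dipath is a directed path with pairwise distinct vertices; its order is its number of vertices (a single vertex is a dipath of order $1$). For $X\subseteq V(D)$, $D-X$ denotes the subdigraph of $D$ induced by $V(D)\setminus X$. *)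

(* Defs.v *)
From mathcomp Require Import all_boot.

Set Implicit Arguments.
Unset Strict Implicit.
Unset Printing Implicit Defensive.

(* A digraph on the finite vertex type T is given by its arc relation
   e : rel T (so there are no parallel arcs); looplessness is the separate
   hypothesis irreflexive e. *)

Definition outdeg (T : finType) (e : rel T) (v : T) : nat := #|[set w | e v w]|.
Definition indeg (T : finType) (e : rel T) (v : T) : nat := #|[set u | e u v]|.

(* Every degree is at most #|T|, so the default value of the iterated minimum
   does not affect it when T is nonempty. *)
Definition min_outdeg (T : finType) (e : rel T) : nat :=
  \big[minn/#|T|]_(v : T) outdeg e v.
Definition min_indeg (T : finType) (e : rel T) : nat :=
  \big[minn/#|T|]_(v : T) indeg e v.
Definition min_semideg (T : finType) (e : rel T) : nat :=
  minn (min_outdeg e) (min_indeg e).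

(* Digraphs have a nonempty vertex set by convention, so the empty digraph is
   not strongly connected. *)
Definition strongly_connected (T : finType) (e : rel T) : bool :=
  (0 < #|T|) && [forall x, forall y, connect e x y].

Definition dipath (T : finType) (e : rel T) (p : seq T) : bool :=
  [&& p != [::], sorted e p & uniq p].

(* D - X, as a digraph on the subtype of vertices outside X. *)
Definition del_vertices (T : finType) (e : rel T) (X : {set T}) :
    rel {x : T | x \notin X} :=
  fun x y => e (val x) (val y).
Arguments del_vertices {T} e X _ _.

(* Main.v *)
(** Let C be a largest strongly connected vertex set whose complement H contains
    a dipath of order m.  If v in H has an in-neighbour in C, then every dipath
    of order m in H contains v (see [unavoidable_out_neighbor]), while vertices
    of H without such an in-neighbour have all their in-neighbours in H.  If H
    had more than m vertices, any dipath of order m in H could then be shifted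
    by one step, attaching its beginning to a maximal path outside it; v would
    move to the front and finally leave the path, a contradiction.  So H is
    itself the vertex set of a dipath of order m. *)

Require Import Defs.
From mathcomp Require Import all_boot zify.

Set Implicit Arguments.
Unset Strict Implicit.
Unset Printing Implicit Defensive.

(** * Paths inside a vertex set: maximal paths and shifting *)

Section Paths.

Variable T : finType.
Implicit Types (e : rel T) (A S U : {set T}) (p q : seq T).

(** Unlike in [dipath], the empty sequence is allowed, so that every prefix of such a path is again
    one. *)
Definition path_in e S p := [&& sorted e p, uniq p & all [in S] p].

Definition has_path_in e m S := [exists p : m.-tuple T, path_in e S p].

Lemma has_path_inP e m S :
  reflect (exists2 p, path_in e S p & size p = m) (has_path_in e m S).
Proof.
apply: (iffP existsP) => [[p Hp]|[p Hp sz]].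
  by exists p; rewrite ?size_tuple.
by move/eqP: sz => sz; exists (Tuple sz).
Qed.

Lemma path_inS e S S' p : S \subset S' -> path_in e S p -> path_in e S' p.
Proof.
move=> /subsetP sS /and3P[so un al]; apply/and3P; split=> //.
exact: sub_all al.
Qed.

Lemma path_in_take e S p n : path_in e S p -> path_in e S (take n p).
Proof.
move=> /and3P[so un al]; apply/and3P; split.
- exact: take_sorted.
- exact: take_uniq.
- by apply/allP=> x /mem_take; move/allP: al; apply.
Qed.

Lemma path_in_rev e S p :
  path_in (fun x y => e y x) S (rev p) = path_in e S p.
Proof. by rewrite /path_in rev_sorted rev_uniq all_rev. Qed.

Lemma has_path_in_rev e m S :
  has_path_in (fun x y => e y x) m S -> has_path_in e m S.
Proof.
case/has_path_inP=> p Hp sz; apply/has_path_inP.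
by exists (rev p); [rewrite path_in_rev|rewrite size_rev].
Qed.

Lemma card_uniq_in p S : uniq p -> all [in S] p -> size p <= #|S|.
Proof.
move=> un /allP al; rewrite -(card_uniqP un).
by apply/subset_leq_card/subsetP.
Qed.

(** Keep prepending a new in-neighbour of the first vertex while [U] has one; finiteness of [U] ends
    this. *)
Lemma maximal_path_in e U x : x \in U ->
  exists y q, path_in e U (y :: q) /\
    (forall u, u \in U -> e u y -> u \in y :: q).
Proof.
move=> xU.
suff H n y q : #|U| - size (y :: q) <= n -> path_in e U (y :: q) ->
    exists y q, path_in e U (y :: q) /\
      (forall u, u \in U -> e u y -> u \in y :: q).
  by apply: (H #|U| x [::]); rewrite ?leq_subr // /path_in /= xU.
elim: n y q => [|n IH] y q lt_n Hq;
  case: (pickP [pred u | [&& u \in U, e u y & u \notin y :: q]]) => [u|no].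
2,4: exists y, q; split=> // u uU euy; apply/negPn/negP=> uq;
     by have := no u; rewrite /= uU euy uq.
all: case/and3P=> uU euy uq; case/and3P: (Hq) => so un al.
all: have Huq : path_in e U [:: u, y & q]
  by apply/and3P; split; rewrite ?cons_uniq ?uq //=; [rewrite euy | rewrite uU].
- have := @card_uniq_in [:: u, y & q] U.
  by case/and3P: Huq => _ -> -> /(_ isT isT); move: lt_n => /=; lia.
- by apply: (IH u (y :: q)) => //; move: lt_n => /=; lia.
Qed.

(** On a maximal path, all in-neighbours in [S] of the first vertex lie on the tail, as there are no
    loops; so the tail has at least [m] vertices. *)
Lemma greedy_path e m S x : irreflexive e -> x \in S ->
  (forall y, y \in S -> m <= #|[set u in S | e u y]|) ->
  has_path_in e m S.
Proof.
move=> irr xS deg.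
have [y [q [Hq maxq]]] := maximal_path_in e xS.
have yS : y \in S by case/and3P: Hq => _ _ /andP[].
have le_mq : m <= size q.
  apply: leq_trans (deg y yS) (leq_trans _ (card_size q)).
  apply/subset_leq_card/subsetP=> u; rewrite inE => /andP[uS euy].
  have := maxq u uS euy; rewrite inE => /predU1P[uy|//].
  by rewrite uy irr in euy.
apply/has_path_inP; exists (take m (y :: q)); first exact: path_in_take.
by rewrite size_take /= ltnS le_mq.
Qed.

(* The new path is an initial part of [p] followed by an initial part of a
   maximal path outside [x :: p]. *)
Lemma shift_path e m S x p :
    irreflexive e -> path_in e S (x :: p) -> size (x :: p) = m -> m < #|S| ->
    (forall u, u \in S -> u \notin x :: p -> m <= #|[set w in S | e w u]|) ->
  exists p', [/\ path_in e S p', size p' = m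
    & forall t, t \in p' -> t \in x :: p -> t \in p /\ index t p' = index t p].
Proof.
move=> irr Hp sz ltS deg.
case/and3P: (Hp) => so un al.
pose U := S :\: [set z in x :: p].
have /card_gt0P[u0 u0U] : 0 < #|U|.
  rewrite cardsD subn_gt0.
  apply: leq_ltn_trans ltS; apply: leq_trans (subset_leq_card (subsetIr _ _)) _.
  by rewrite cardsE -sz card_size.
have [y [q [Hq maxq]]] := maximal_path_in e u0U.
case/and3P: (Hq) => soq unq /allP alq.
have yqS z : z \in y :: q -> z \in S /\ z \notin x :: p.
  by move/alq; rewrite !inE => /andP[].
(* The head [x] is dropped, so a vertex kept from [p] moves one place forward. *)
suff [i [Hpath szi]] : exists i,
    path_in e S (take i p ++ y :: q) /\ m <= size (take i p ++ y :: q).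
  exists (take m (take i p ++ y :: q)); split.
  - exact: path_in_take.
  - by rewrite size_takel.
  move=> t /[dup] tp' /mem_take; rewrite mem_cat => /orP[tp|tyq] txp; last first.
    by case: (yqS t tyq) => _; rewrite txp.
  split; first exact: mem_take tp.
  have := index_cat t (take m (take i p ++ y :: q)) (drop m (take i p ++ y :: q)).
  rewrite tp' cat_take_drop => <-; rewrite index_cat tp.
  by rewrite -[in RHS](cat_take_drop i p) index_cat tp.
have [le_mq|lt_qm] := leqP m (size (y :: q)).
  exists 0; rewrite take0; split=> //.
  by apply: path_inS Hq; apply: subsetDl.
have yS : y \in S /\ y \notin x :: p by apply: yqS; rewrite mem_head.
(* [B] has fewer than [m] entries, so [y] has an in-neighbour in [S] outside [B]. By maximality of
   [y :: q] it lies on [x :: p], at a position [i] so late that [take i p], which ends there,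
   followed by [y :: q] has at least [m] vertices. *)
pose B := q ++ take (m - size (y :: q)) (x :: p).
have /subsetPn[u] : ~~ ([set w in S | e w y] \subset [set z in B]).
  apply/negP=> /subset_leq_card leB.
  have := leq_trans (deg y yS.1 yS.2) leB.
  rewrite leqNgt cardsE (leq_ltn_trans (card_size B)) //.
  rewrite size_cat size_takel ?sz ?leq_subr //.
  by move: lt_qm => /=; lia.
rewrite !inE => /andP[uS euy]; rewrite mem_cat negb_or => /andP[uq uxp].
have u_xp : u \in x :: p.
  apply/negPn/negP=> uNxp.
  have := maxq u; rewrite !inE uS -in_cons (negPf uNxp) => /(_ isT euy).
  by case/predU1P=> [uy|]; [rewrite uy irr in euy|apply/negP].
pose i := index u (x :: p).
have lt_i : i <= size p by rewrite -ltnS -[(size p).+1]/(size (x :: p)) index_mem.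
have le_i : m - size (y :: q) <= i.
  rewrite leqNgt; apply: contra uxp => lt_im.
  have := nth_index x u_xp; rewrite -/i -(nth_take x lt_im) => <-.
  apply: mem_nth; rewrite size_takel ?sz ?leq_subr //.
have un' : uniq (take i p ++ y :: q).
  rewrite cat_uniq take_uniq ?unq ?andbT; last by case/andP: un.
  apply/hasPn=> z /yqS[_]; apply: contra => /mem_take.
  by rewrite inE => ->; rewrite orbT.
exists i; split; last by rewrite size_cat size_takel // addnC -leq_subLR.
apply/and3P; split=> //.
  apply: (@path_sorted _ e x); rewrite cat_path take_path //=.
  suff -> : last x (take i p) = u by rewrite euy.
  by rewrite -(nth_last x) size_takel // -[RHS](nth_index x u_xp) -/i;
     case: i lt_i {le_i un'} => [|i] lt_i /=; rewrite ?take0 // nth_take.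
rewrite all_cat; apply/andP; split; last by apply/allP=> z /yqS[].
by apply/allP=> z /mem_take zp; move/allP: al; apply; rewrite inE zp orbT.
Qed.

(** If [S] were larger, [shift_path] would apply to every path of order [m], since vertices off the
    path are not in [X]. The new path must still contain [t], but one place earlier; this cannot go
    on forever. *)
Lemma card_le_of_unavoidable e m S (X : {set T}) t :
    irreflexive e -> t \in X -> has_path_in e m S ->
    (forall p, path_in e S p -> size p = m -> {subset X <= p}) ->
    (forall x, x \in S -> x \notin X -> m <= #|[set u in S | e u x]|) ->
  #|S| <= m.
Proof.
move=> irr tX /has_path_inP[p0 Hp0 szp0] allX deg.
rewrite leqNgt; apply/negP=> ltS.
suff H n p : path_in e S p -> size p = m -> index t p = n -> False.
  exact: (H _ p0).
elim: n p => [|n IH] [|x p] Hp sz; try by have := allX _ Hp sz t tX.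
all: have [|p' [Hp' sz' tp']] := shift_path irr Hp sz ltS.
1,3: by move=> u uS up; apply: deg => //; apply: contra up; apply: allX Hp sz _.
all: have [tp idx] := tp' t (allX _ Hp' sz' t tX) (allX _ Hp sz t tX).
(* Here [t] is the head [x], and surviving the shift would force it to occur again in [p]. *)
- rewrite /=; case: eqP => // xt _.
  by case/and3P: Hp => _ /= /andP[]; rewrite xt tp.
- rewrite /=; case: eqP => // _ [idn].
  by apply: IH Hp' sz' _; rewrite idx.
Qed.

End Paths.

(** * Strong connectivity of induced subdigraphs *)

Section Restriction.

Variables (T : finType) (e : rel T).
Implicit Types (A B : {set T}).

(** Kept on all of [T], with vertices outside [A] isolated, so that [A] can vary without changing
    the type. *)
Definition restr A : rel T := fun x y => [&& x \in A, y \in A & e x y].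

Definition strong A :=
  (A != set0) && [forall x in A, forall y in A, connect (restr A) x y].

Lemma strongP A :
  reflect (A != set0 /\ {in A &, forall x y, connect (restr A) x y}) (strong A).
Proof.
apply: (iffP andP) => [[A0 /forall_inP conA]|[A0 conA]]; split=> //.
  by move=> x y xA yA; move/forall_inP: (conA x xA); apply.
by apply/forall_inP=> x xA; apply/forall_inP=> y yA; apply: conA.
Qed.

Lemma connect_restrS A B x y :
  A \subset B -> connect (restr A) x y -> connect (restr B) x y.
Proof.
move=> /subsetP sAB; apply: connect_sub => u w /and3P[uA wA euw].
by apply: connect1; rewrite /restr !sAB.
Qed.

Lemma connect_exit A x y : connect e x y -> x \in A -> y \notin A ->
  exists a b, [/\ a \in A, b \notin A & e a b].
Proof.
case/connectP=> p; elim: p x => [|z p IH] x /=.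
  by move=> _ -> ->.
case/andP=> exz Hp lasty xA yA.
have [zA|zA] := boolP (z \in A); first exact: (IH z).
by exists x, z.
Qed.

Definition reach A x := [set y in A | connect (restr A) x y].

Lemma connect_reach A x y z : y \in reach A x ->
  connect (restr A) y z -> connect (restr (reach A x)) y z.
Proof.
move=> yR /connectP[p]; elim: p y yR => [|w p IH] y yR /=; first by move=> _ ->.
case/andP=> yw Hp lastz; have [_ wA eyw] := and3P yw.
have wR : w \in reach A x.
  move: yR; rewrite !inE wA => /andP[_ xy] /=.
  exact: connect_trans xy (connect1 yw).
apply: connect_trans (IH w wR Hp lastz).
by apply: connect1; rewrite /restr yR wR.
Qed.

(** Go from [y] back to [x] inside [A], then on to [z]; by [connect_reach] this walk never leaves
    the reachable set. *)
Lemma strong_reach A x : x \in A ->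
  (forall y, y \in A -> connect (restr A) y x) -> strong (reach A x).
Proof.
move=> xA toA; apply/strongP; split.
  by apply/set0Pn; exists x; rewrite inE xA connect0.
move=> y z yR; rewrite inE => /andP[zA xz]; apply: connect_reach => //.
by apply: connect_trans (toA y _) xz; move: yR; rewrite inE => /andP[].
Qed.

Lemma strong_del_vertices (X : {set T}) :
  strong (~: X) -> strongly_connected (del_vertices e X).
Proof.
case/strongP=> /set0Pn[x0]; rewrite inE => x0X conX; apply/andP; split.
  by apply/card_gt0P; exists (exist _ x0 x0X).
apply/forallP=> x; apply/forallP=> y.
have /connectP[p] : connect (restr (~: X)) (val x) (val y).
  by apply: conX; rewrite inE; [exact: (valP x) | exact: (valP y)].
elim: p x => [|z p IH] x /=; first by move=> _ /val_inj ->.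
case/andP=> /and3P[_ zX exz] Hp lasty; rewrite inE in zX.
apply: (@connect_trans _ _ (exist _ z zX)); last exact: IH.
exact: connect1.
Qed.

End Restriction.

(** * The complement of a largest strong set *)

Section MaximalStrong.

Variables (T : finType) (e : rel T) (m : nat) (C : {set T}).
Hypotheses (irr : irreflexive e) (sc_e : forall x y, connect e x y).
Hypothesis outdeg_e : forall x, m < #|[set y | e x y]|.
Hypothesis indeg_e : forall x, m < #|[set y | e y x]|.
Hypotheses (m_gt0 : 0 < m) (strongC : strong e C).
Hypothesis pathC : has_path_in e m (~: C).
Hypothesis maxC : forall A, strong e A -> has_path_in e m (~: A) -> #|A| <= #|C|.

(* A set [Q] containing [C] and avoiding [v], from which [C] can be reached, is
   taken maximal subject to leaving a path of order [m] outside [Q] and [v].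
   Then all such paths contain every vertex with an arc to [Q], while [v] itself
   has no such arc by maximality of [C]; the shifting argument, with arcs
   reversed, then bounds the number of remaining vertices by [m], although they
   include all out-neighbors of [v]. *)
Lemma unavoidable_out_neighbor c v p : c \in C -> v \notin C -> e c v ->
  path_in e (~: C) p -> size p = m -> v \in p.
Proof.
move=> cC vC ecv Hp sz; apply/negPn/negP=> vp.
pose good (Q : {set T}) := [&& C \subset Q, v \notin Q,
  [forall x in Q, connect (restr e Q) x c] & has_path_in e m (~: (v |: Q))].
have goodC : good C.
  apply/and4P; split=> //.
    by apply/forall_inP=> x xC; have [_] := strongP _ _ strongC; apply.
  apply/has_path_inP; exists p => //; case/and3P: Hp => so un al.
  apply/and3P; split=> //; apply/allP=> z zp.
  have := allP al z zp; rewrite !inE negb_or => ->; rewrite andbT.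
  by apply: contraNneq vp => <-.
case: (arg_maxnP (fun Q : {set T} => #|Q|) goodC) => Q.
case/and4P=> sCQ vQ /forall_inP toc pathQ maxQ.
have cQ : c \in Q by apply: (subsetP sCQ).
pose S := ~: (v |: Q).
have v_out w : e v w -> w \in S.
  move=> evw; rewrite !inE negb_or; apply/andP; split.
    by apply: contraTneq evw => ->; rewrite irr.
  apply/negP=> wQ.
  (* With an arc from [v] to [Q], all of [v |: Q] can reach [c], so the part reachable from [c] is
     strong; it contains [C] and [v], against [maxC]. *)
  have strongR : strong e (reach e (v |: Q) c).
    apply: strong_reach; first by rewrite inE cQ orbT.
    have toc' x : x \in Q -> connect (restr e (v |: Q)) x c.
      by move=> /toc; apply: connect_restrS; apply: subsetUr.
    move=> y /setU1P[->|]; last exact: toc'.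
    apply: connect_trans (toc' w wQ); apply: connect1.
    by rewrite /restr !inE eqxx wQ orbT.
  have pathR : has_path_in e m (~: reach e (v |: Q) c).
    case/has_path_inP: pathQ => p' Hp' sz'; apply/has_path_inP; exists p' => //.
    by apply: path_inS Hp'; rewrite setCS; apply/subsetP=> x; rewrite inE => /andP[].
  have := maxC strongR pathR; rewrite leqNgt => /negP; apply.
  apply/proper_card/properP; split.
    apply/subsetP=> x xC; rewrite inE inE (subsetP sCQ) ?orbT //=.
    have [_ conC] := strongP _ _ strongC.
    apply: connect_restrS (conC c x cC xC).
    exact: subset_trans sCQ (subsetUr _ _).
  exists v => //; rewrite !inE eqxx /=.
  by apply: connect1; rewrite /restr !inE eqxx cQ orbT.
pose X := [set t in S | [exists w in Q, e t w]].
have allX q : path_in e S q -> size q = m -> {subset X <= q}.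
  move=> Hq szq t; rewrite inE => /andP[tS /exists_inP[w wQ etw]].
  apply/negPn/negP=> tq.
  have /andP[tv tQ] : (t != v) && (t \notin Q) by move: tS; rewrite !inE negb_or.
  suff /maxQ : good (t |: Q) by rewrite cardsU1 tQ /= add1n ltnn.
  apply/and4P; split.
  - exact: subset_trans sCQ (subsetUr _ _).
  - by rewrite !inE negb_or eq_sym tv.
  - apply/forall_inP=> x.
    have toc' y : y \in Q -> connect (restr e (t |: Q)) y c.
      by move=> /toc; apply: connect_restrS; apply: subsetUr.
    case/setU1P=> [->|]; last exact: toc'.
    apply: connect_trans (toc' w wQ); apply: connect1.
    by rewrite /restr !inE eqxx wQ orbT.
  - apply/has_path_inP; exists q => //; case/and3P: Hq => so un al.
    apply/and3P; split=> //; apply/allP=> z zq.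
    have := allP al z zq; rewrite !inE !negb_or => /andP[-> ->]; rewrite andbT /=.
    by apply: contraNneq tq => <-.
(* On a walk from [S] to [c], the first arc entering [Q] starts in [X]: its tail is not [v], whose
   out-neighbours all lie in [S]. *)
have [t tX] : exists t, t \in X.
  have [y] : exists y, y \in S.
    case/has_path_inP: pathQ => [[|y q]] Hq szq; first by move: m_gt0; rewrite -szq.
    by exists y; case/and3P: Hq => _ _ /andP[].
  rewrite !inE negb_or => /andP[_ yQ].
  have [|||a [b [aQ bQ eab]]] := @connect_exit _ e (~: Q) y c.
  - exact: sc_e.
  - by rewrite inE.
  - by rewrite inE cQ.
  rewrite !inE negbK in aQ bQ.
  exists a; rewrite !inE negb_or aQ andbT; apply/andP; split.
    apply: contraTneq eab => ->; apply/negP=> /v_out.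
    by rewrite !inE bQ orbT.
  by apply/exists_inP; exists b.
suff : #|S| <= m.
  rewrite leqNgt => /negP; apply; apply: leq_trans (outdeg_e v) _.
  by apply/subset_leq_card/subsetP=> w; rewrite inE => /v_out.
apply: (@card_le_of_unavoidable _ (fun x y => e y x) m S X t) => //.
- exact: has_path_in_rev.
- move=> q Hq szq x xX; rewrite -mem_rev; apply: allX xX; last by rewrite size_rev.
  by rewrite -path_in_rev revK.
(* All out-neighbours of [x] lie in [S], except possibly [v]; the degree bound [m + 1] allows for
   this loss. *)
- move=> x xS xX; rewrite -ltnS; apply: leq_trans (outdeg_e x) _.
  have -> : #|[set u in S | e x u]|.+1 = #|v |: [set u in S | e x u]|.
    by rewrite cardsU1 !inE eqxx.
  apply/subset_leq_card/subsetP=> u; rewrite !inE => exu.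
  case: (u =P v) => //= _; rewrite exu andbT.
  by apply: contra xX => uQ; rewrite inE xS; apply/exists_inP; exists u.
Qed.

Lemma card_setC_maximal_strong : #|~: C| <= m.
Proof.
pose X := [set v in ~: C | [exists c in C, e c v]].
have [y] : exists y, y \in ~: C.
  case/has_path_inP: pathC => [[|y q]] Hq szq; first by move: m_gt0; rewrite -szq.
  by exists y; case/and3P: Hq => _ _ /andP[].
rewrite inE => yC; have [/set0Pn[c cC] _] := strongP _ _ strongC.
(* The head [b] of an arc leaving [C] shows that [X] is nonempty. *)
have [a [b [aC bC eab]]] := connect_exit (sc_e c y) cC yC.
apply: (@card_le_of_unavoidable _ e m _ X b) => //.
- by rewrite !inE bC; apply/exists_inP; exists a.
- move=> p Hp sz v; rewrite !inE => /andP[vC /exists_inP[w wC ewv]].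
  exact: unavoidable_out_neighbor wC vC ewv Hp sz.
- move=> x xC xX; apply: leq_trans (ltnW (indeg_e x)) _.
  apply/subset_leq_card/subsetP=> u; rewrite !inE => eux; rewrite eux andbT.
  by apply: contra xX => uC; rewrite inE xC; apply/exists_inP; exists u.
Qed.

End MaximalStrong.

Lemma bigminn_le (I : finType) d (F : I -> nat) x :
  \big[minn/d]_(i : I) F i <= F x.
Proof.
have: x \in index_enum I by rewrite mem_index_enum.
elim: (index_enum I) => // y r IH; rewrite inE big_cons geq_min.
by case/predU1P=> [->|/IH ->]; rewrite ?leqnn ?orbT.
Qed.

Theorem theorem1p3 (m : nat) (hm : 0 < m) (T : finType) (e : rel T)
    (loopless_e : irreflexive e) (sc_e : strongly_connected e)
    (semideg_e : m.+1 <= min_semideg e) :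
  exists p : seq T,
    [/\ dipath e p, size p = m
      & strongly_connected (del_vertices e [set x in p])].
Proof.
case/andP: sc_e => /card_gt0P[c _] /forallP sc_e.
have sc x y : connect e x y by move/forallP: (sc_e x).
move: semideg_e; rewrite /min_semideg leq_min => /andP[out_e in_e].
have outd x : m < #|[set y | e x y]|.
  by apply: leq_trans out_e _; exact: bigminn_le.
have ind x : m < #|[set y | e y x]|.
  by apply: leq_trans in_e _; exact: bigminn_le.
pose good (A : {set T}) := strong e A && has_path_in e m (~: A).
(* Removing [c] lowers each in-degree by at most one, so [greedy_path] still finds a path of order
   [m]. *)
have good1 : good [set c].
  apply/andP; split.
    apply/strongP; split; first by apply/set0Pn; exists c; rewrite inE.
    by move=> x y /set1P-> /set1P->.
  have /card_gt0P[x] : 0 < #|[set y | e c y]| by apply: leq_trans (outd c).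
  rewrite inE => ecx; apply: (@greedy_path _ e m _ x) => //.
    by rewrite !inE; apply: contraTneq ecx => ->; rewrite loopless_e.
  move=> y _; rewrite -ltnS; apply: leq_trans (ind y) _.
  have -> : #|[set u in ~: [set c] | e u y]|.+1
          = #|c |: [set u in ~: [set c] | e u y]| by rewrite cardsU1 !inE eqxx.
  by apply/subset_leq_card/subsetP=> u; rewrite !inE => ->; case: eqP.
case: (arg_maxnP (fun A : {set T} => #|A|) good1) => C /andP[strongC pathC] maxC.
have leC : #|~: C| <= m.
  apply: (card_setC_maximal_strong loopless_e sc outd ind hm strongC pathC).
  by move=> A sA pA; apply: maxC; rewrite /good sA.
case/has_path_inP: pathC => p /and3P[so un al] sz; exists p; split=> //.
  by rewrite /dipath so un; case: p sz {so un al} hm => //= <-.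
(* [p] has [m] distinct vertices in [~: C], which has at most [m]. *)
have <- : ~: C = [set x in p].
  apply/esym/eqP; rewrite eqEcard; apply/andP; split.
    by apply/subsetP=> x; rewrite inE => /(allP al).
  by rewrite [leqRHS]cardsE (card_uniqP un) sz.
by apply: strong_del_vertices; rewrite setCK.
Qed.
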